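(* Let $P$ be a finite bicolored poset with set of celeste elements $C \subseteq P$. The functions $\Omega_{P,C}(x,y)$ and $\Omega^{\circ}_{P,C}(x,y)$ are polynomials in $x$ and $y$. They satisfy the reciprocity theorem \[ (-1)^{|P|}\, \Omega^{\circ}_{P,C}(-x,-y) \;=\; \Omega_{P,C}(x,y+1). \]
   Context: For a positive integer $x$, $[x] = \{1,2,\dots,x\}$ with its usual order. A bicolored poset is a finite poset $(P,\preceq)$ thought of as the disjoint union of two subsets $C$ (the celeste elements) and $S$ (the silver elements). An order preserving $(x,y)$-map is a map $\varphi : P \to [x]$ such that $a \preceq b$ implies $\varphi(a) \le \varphi(b)$ for all $a,b \in P$, and $\varphi(c) \ge y$ for all $c \in C$. A strictly order preserving $(x,y)$-map is a map $\varphi : P \to [x]$ such that $a \prec b$ implies $\varphi(a) < \varphi(b)$ for all $a,b \in P$, and $\varphi(c) > y$ for all $c \in C$. The functions $\Omega_{P,C}(x,y)$ and $\Omega^{\circ}_{P,C}(x,y)$ count the order preserving $(x,y)$-maps and the strictly order preserving $(x,y)$-maps, respectively. In the reciprocity identity, $\Omega^{\circ}_{P,C}(-x,-y)$ means the evaluation of the polynomial at $(-x,-y)$.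
   Formalization: The counts are shown to agree with polynomials for integers 1 ≤ y ≤ x only; for y > x this fails, e.g. one celeste element has strict count x − y for y ≤ x but 0 for y > x. The reciprocity is an identity of these polynomials. *)

(* Defs.v *)
From HB Require Import structures.
From mathcomp Require Import all_boot all_order all_algebra.

Set Implicit Arguments.
Unset Strict Implicit.
Unset Printing Implicit Defensive.

Import Order.TTheory GRing.Theory Num.Theory.

(* The finite type 'I_x models [x] = {1, ..., x}; the ordinal i < x stands for
   the label i + 1. *)
Definition label (x : nat) (i : 'I_x) : nat := i.+1.

Section BicoloredPoset.
Context {d : Order.disp_t} {P : finPOrderType d}.

(* The set C : {set P} consists of the celeste elements; the silver elements
   are those of ~: C. *)
Definition order_preserving_map (C : {set P}) (x y : nat)
    (phi : {ffun P -> 'I_x}) : bool :=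
  [forall a : P, forall b : P,
     (a <= b)%O ==> (label (phi a) <= label (phi b))%N] &&
  [forall c in C, (y <= label (phi c))%N].

Definition strictly_order_preserving_map (C : {set P}) (x y : nat)
    (phi : {ffun P -> 'I_x}) : bool :=
  [forall a : P, forall b : P,
     (a < b)%O ==> (label (phi a) < label (phi b))%N] &&
  [forall c in C, (y < label (phi c))%N].

Definition Omega (C : {set P}) (x y : nat) : nat :=
  #|[set phi : {ffun P -> 'I_x} | order_preserving_map C y phi]|.

Definition Omega_strict (C : {set P}) (x y : nat) : nat :=
  #|[set phi : {ffun P -> 'I_x} | strictly_order_preserving_map C y phi]|.

End BicoloredPoset.

(* The variables range over positive integers with y <= x.  The bound y <= x
   cannot be dropped: for a single celeste element the strict count is x - y
   when y <= x, but 0 when y > x.  Since the pairs with 1 <= y <= x are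
   Zariski dense, at most one polynomial p satisfies this. *)
Definition is_given_by_polynomial (f : nat -> nat -> nat)
    (p : {poly {poly rat}}) : Prop :=
  forall x y : nat, (1 <= y <= x)%N ->
    (p.[x%:R, y%:R] = (f x y)%:R :> rat)%R.

(* Main.v *)
Require Import Defs.
From mathcomp Require Import all_boot all_order all_algebra.
From mathcomp Require Import ring.

Set Implicit Arguments.
Unset Strict Implicit.
Unset Printing Implicit Defensive.

Import Order.TTheory GRing.Theory Num.Theory.

Local Open Scope ring_scope.

(* Peeling off the top value of a map shows that the counts are obtained by
   iterating transfer matrices indexed by the subsets of P: zeta A I = 1 when I
   is a down-set of A in the weak case, with A \ I moreover an antichain in the
   strict case.  Since zeta - 1 is nilpotent, the entries of zeta ^ n are
   polynomials in n; and up to the signs (-1) ^ #|A \ I| the strict matrix is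
   the inverse of zeta, so its powers are the values of the same polynomials at
   - n.  The celeste constraint only splits a map at the threshold into the part
   below it, supported on a down-set without celeste elements, and the
   unconstrained part above it; reciprocity applies to each factor. *)

(** * Bivariate evaluation and uniqueness of the interpolating polynomial *)

Lemma poly_eq0_inj_roots (R : idomainType) (h : nat -> R) (p : {poly R}) :
  injective h -> (forall n, p.[h n] = 0) -> p = 0.
Proof.
move=> h_inj ph0; apply: (@roots_geq_poly_eq0 _ p (mkseq h (size p))).
- by apply/allP=> _ /mapP[n _ ->]; rewrite rootE ph0.
- by rewrite mkseq_uniq.
- by rewrite size_mkseq.
Qed.

Lemma horner2_comp (R : comNzRingType) (p : {poly R}) (u : {poly {poly R}})
    (x y : R) :
  (p^:P \Po u).[x, y] = p.[u.[x, y]].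
Proof. by rewrite horner_comp -[p^:P.[_]]/(p \Po _) horner_comp. Qed.

(* Fixing [y] first leaves infinitely many admissible values of [x]. *)
Lemma given_by_polynomial_uniq (f : nat -> nat -> nat)
    (p q : {poly {poly rat}}) :
  is_given_by_polynomial f p -> is_given_by_polynomial f q -> p = q.
Proof.
move=> fp fq; apply/eqP; rewrite -subr_eq0 -swapXY_eq0; apply/eqP.
have nat_inj k : injective (fun n => (k + n)%:R : rat).
  by move=> m n /eqP; rewrite eqr_nat eqn_add2l => /eqP.
(* After the swap the outer variable is [y], taken at [n + 1]; the inner one is [x], taken at
   [n + 1 + k], so that [1 <= y <= x] holds. *)
apply: (@poly_eq0_inj_roots _ (fun n => (1 + n)%:R%:P)) => [|n].
  exact: inj_comp (@polyC_inj _) (nat_inj 1%N).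
apply: (poly_eq0_inj_roots (nat_inj n.+1)) => k.
rewrite horner2_swapXY !hornerE fp ?fq ?subrr //.
  by rewrite add1n leq_addr.
by rewrite add1n leq_addr.
Qed.

(** * Binomial coefficients as polynomials *)

Definition binomial_poly (k : nat) : {poly rat} :=
  (k`!%:R)^-1 *: \prod_(i < k) ('X - i%:R%:P).

Lemma binomial_poly0 (k : nat) : (binomial_poly k).[0] = (k == 0)%:R.
Proof.
rewrite /binomial_poly hornerZ horner_prod; case: k => [|k].
  by rewrite big_ord0 mulr1 invr1.
by rewrite big_ord_recl hornerXsubC subr0 mul0r mulr0.
Qed.

(** Pascal's rule: all three terms share the product of the [t - i] for [i < k], abstracted as
    [w]. *)
Lemma binomial_polyS (k : nat) (t : rat) :
  (binomial_poly k.+1).[t + 1]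
    = (binomial_poly k.+1).[t] + (binomial_poly k).[t].
Proof.
rewrite /binomial_poly !hornerZ !horner_prod big_ord_recl big_ord_recr /=.
under eq_bigr => i _ do
  rewrite hornerXsubC /bump leq0n natrD opprD addrA addrK -hornerXsubC.
rewrite !hornerXsubC subr0 factS natrM.
have: k.+1%:R != 0 :> rat by rewrite pnatr_eq0.
have: k`!%:R != 0 :> rat by rewrite pnatr_eq0 -lt0n fact_gt0.
rewrite -natr1; move: (\prod_(i < k) _) => w /= k0 k1.
by field; rewrite k0 k1.
Qed.

(** * Layers and the inverse of [zeta] by a sign-reversing involution *)

Section Layers.
Context {d : Order.disp_t} {P : finPOrderType d}.
Implicit Types (A I J : {set P}) (s : bool) (C : {set P}).

(* [A :\: I] is a possible top level set of an order preserving
   ([s = false]) or strictly order preserving ([s = true]) map on [A]. *)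
Definition layer s A I : bool :=
  [&& I \subset A,
      [forall a in A, forall b in I, (a < b)%O ==> (a \in I)]
    & s ==> [forall a in A :\: I, forall b in A :\: I, ~~ (a < b)%O]].

Lemma layerP s A I :
  reflect [/\ I \subset A,
              forall a b, a \in A -> b \in I -> (a < b)%O -> a \in I
            & s -> forall a b, a \in A -> a \notin I -> b \in A ->
                b \notin I -> ~~ (a < b)%O]
          (layer s A I).
Proof.
apply: (iffP and3P) => -[IA down anti]; split=> //.
- move=> a b aA bI; apply/implyP.
  by move/forall_inP/(_ a aA)/forall_inP: down; apply.
- move=> hs a b aA aI bA bI; move: anti; rewrite hs.
  move/forall_inP/(_ a)/[!inE]/(_ _)/forall_inP/(_ b) => -> //;
    by rewrite ?inE ?aI ?bI.
- apply/forall_inP=> a aA; apply/forall_inP=> b bI; apply/implyP.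
  exact: down bI.
- apply/implyP=> hs; apply/forall_inP=> a /setDP[aA aI].
  by apply/forall_inP=> b /setDP[bA bI]; exact: anti.
Qed.

Lemma layer_refl s A : layer s A A.
Proof. by apply/layerP; split=> // _ a b ->. Qed.

Lemma layer_trans A J I : layer false A J -> layer false J I -> layer false A I.
Proof.
move=> /layerP[JA dJ _] /layerP[IJ dI _]; apply/layerP; split=> //.
  exact: subset_trans JA.
move=> a b aA bI ab; apply: (dI _ b) => //.
by apply: (dJ _ b) => //; apply: (subsetP IJ).
Qed.

Lemma layerW A I : layer true A I -> layer false A I.
Proof. by case/layerP=> IA dI _; apply/layerP; split. Qed.

Definition toggle (m : P) J : {set P} := if m \in J then J :\ m else m |: J.

Lemma toggleK m : involutive (toggle m).
Proof.
move=> J; rewrite [toggle m J]/toggle.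
case: ifPn => mJ; rewrite /toggle !inE eqxx /=.
  exact: setD1K.
by rewrite setU1K.
Qed.

Lemma sign_toggle m J : (-1) ^+ #|toggle m J| = - (-1) ^+ #|J| :> rat.
Proof.
rewrite /toggle; case: ifP => mJ.
  by rewrite [in RHS](cardsD1 m) mJ exprS mulN1r opprK.
by rewrite cardsU1 mJ exprS mulN1r.
Qed.

(** As [m] is maximal in [A], removing it keeps [J] a down-set, and all elements of [A] below [m]
    stay in [J], so the complement stays an antichain. Conversely, if [m] is not in [J], the
    antichain condition already puts the elements of [A] below [m] into [J], so [m] can be added. *)
Lemma toggle_layer m A I J :
    m \in A -> m \notin I -> (forall b, b \in A -> ~~ (m < b)%O) ->
  layer true A J && layer false J I ->
  layer true A (toggle m J) && layer false (toggle m J) I.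
Proof.
move=> mA mI mmax /andP[/layerP[JA dJ aJ] /layerP[IJ dI _]].
rewrite /toggle; case: ifP => mJ; apply/andP; split; apply/layerP; split=> //.
- by apply: subset_trans JA; exact: subsetDl.
- move=> a b aA /setD1P[bm bJ] ab; rewrite !inE (dJ a b) // andbT.
  by apply: contraTneq ab => ->; rewrite mmax // (subsetP JA).
- move=> _ a b aA; rewrite !inE => aJ' bA bJ'.
  case: (eqVneq a m) aJ' => [->|am /= aJ']; first by rewrite mmax.
  case: (eqVneq b m) bJ' => [-> _|bm /= bJ']; last exact: aJ.
  by apply/negP => /(dJ _ _ aA mJ); apply/negP.
- by rewrite subsetD1 IJ.
- by move=> a b /setD1P[_ aJ'] bI; exact: dI.
- by rewrite subUset sub1set mA.
- move=> a b aA /setU1P[->|bJ] ab; rewrite !inE; last by rewrite (dJ a b) ?orbT.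
  apply/orP; right; apply: contraLR ab => aJ'.
  by apply: aJ; rewrite ?mJ.
- move=> _ a b aA; rewrite !inE !negb_or => /andP[_ aJ'] bA /andP[_ bJ'].
  exact: aJ.
- by apply: subset_trans IJ _; exact: subsetUr.
- move=> a b /setU1P[->|aJ'] bI ab; last exact: dI ab.
  by move: (mmax b); rewrite ab (subsetP JA) ?(subsetP IJ) // => /(_ isT).
Qed.

Lemma exists_max A : A != set0 ->
  exists2 m, m \in A & forall b, b \in A -> ~~ (m < b)%O.
Proof.
case/set0Pn=> x xA.
pose up a := #|[set b in A | (a < b)%O]|.
(* An element of [A] above [m] would have strictly fewer elements above it. *)
have [m mA min_m] := arg_minnP up xA.
exists m => // b bA; apply/negP => mb; have := min_m b bA.
rewrite leqNgt => /negP; apply; apply: proper_card; apply/properP; split.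
  by apply/subsetP=> c; rewrite !inE => /andP[-> /(lt_trans mb)].
by exists b; rewrite inE bA ?ltxx // mb.
Qed.

(* Toggling a maximal element of [A :\: I] in [J] cancels the terms of the sum
   in pairs. *)
Lemma layer_mobius A I :
  \sum_(J | layer true A J && layer false J I) (-1) ^+ (#|A| + #|J|)
    = (A == I)%:R :> rat.
Proof.
case: (eqVneq A I) => [<-|AI].
  rewrite (big_pred1 A) => [|J /=]; first by rewrite exprD -expr2 sqrr_sign.
  apply/idP/eqP => [/andP[/layerP[JA _ _] /layerP[AJ _ _]]|->].
    by apply/eqP; rewrite eqEsubset JA.
  by rewrite !layer_refl.
case: (boolP (layer false A I)) => [AI_layer|nAI]; last first.
  rewrite big_pred0 // => J; apply: contraNF nAI => /andP[/layerW AJ].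
  exact: layer_trans.
have /layerP[IA dI _] := AI_layer.
have [|m /setDP[mA mI] mmax] := @exists_max (A :\: I).
  apply: contraNneq AI => /eqP; rewrite setD_eq0 => AI.
  by rewrite eqEsubset AI.
(* Maximality extends from [A :\: I] to [A]: an element of the down-set [I] above [m] would force
   [m] into [I]. *)
have {}mmax b : b \in A -> ~~ (m < b)%O.
  move=> bA; case: (boolP (b \in I)) => bI; last by rewrite mmax ?inE ?bI.
  by apply: contra mI; exact: dI.
set S := LHS; suff: S = - S.
  by move/eqP; rewrite -addr_eq0 -mulr2n mulrn_eq0 => /eqP.
rewrite {1}/S (reindex_inj (inv_inj (toggleK m))) -sumrN.
apply: eq_big => J; last by rewrite !exprD sign_toggle mulrN.
apply/idP/idP; last exact: toggle_layer.
by move/(toggle_layer mA mI mmax); rewrite toggleK.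
Qed.

(** * Polynomial powers of the transfer matrices *)

(** The entry at [A], [I] of [(zeta - 1) ^ k]. *)
Fixpoint proper_chains (k : nat) A I : nat :=
  if k is k'.+1 then
    \sum_(J | layer false A J && (J != A)) proper_chains k' J I
  else A == I.

(** Nilpotency of [zeta - 1]: each proper step loses an element. *)
Lemma proper_chains_gt_card (k : nat) A I :
  (#|A| < k)%N -> proper_chains k A I = 0%N.
Proof.
elim: k A => // k IH A Ak /=; apply: big1 => J /andP[/layerP[JA _ _] JnA].
apply: IH; rewrite -ltnS; apply: leq_trans Ak; rewrite ltnS.
by apply: proper_card; rewrite properEneq JnA.
Qed.

(* The polynomial interpolating the entries [zeta ^ n A I] of the powers of the
   matrix [zeta] of the relation [layer false], obtained by expanding
   [(1 + (zeta - 1)) ^ n] with [zeta - 1] nilpotent. *)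
Definition zeta_poly A I : {poly rat} :=
  \sum_(k < #|P|.+1) (proper_chains k A I)%:R *: binomial_poly k.

Lemma zeta_poly0 A I : (zeta_poly A I).[0] = (A == I)%:R.
Proof.
rewrite /zeta_poly horner_sum big_ord_recl big1 ?addr0.
  by rewrite hornerZ binomial_poly0 mulr1.
by move=> i _; rewrite hornerZ binomial_poly0 mulr0.
Qed.

(** This is [zeta ^ (t + 1) = zeta * zeta ^ t] for rational [t]. The term [J = A] gives [zeta ^ t];
    the others apply [zeta - 1], which raises the chain length by one, and Pascal's rule matches the
    two sides. *)
Lemma zeta_polyS A I (t : rat) :
  (zeta_poly A I).[t + 1] = \sum_(J | layer false A J) (zeta_poly J I).[t].
Proof.
rewrite (bigD1 A) ?layer_refl //= /zeta_poly !horner_sum.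
under [X in _ = _ + X]eq_bigr => J _ do rewrite horner_sum.
rewrite exchange_big /= big_ord_recl [in RHS]big_ord_recl -addrA; congr (_ + _).
  by rewrite !hornerZ /binomial_poly big_ord0 !hornerE.
under [LHS]eq_bigr => k _ do rewrite hornerZ binomial_polyS mulrDr -!hornerZ.
rewrite big_split /=; congr (_ + _).
(* The added term [k = #|P|] vanishes by nilpotency. *)
have -> : \sum_(k < #|P|) ((proper_chains k.+1 A I)%:R *: binomial_poly k).[t]
   = \sum_(k < #|P|.+1) ((proper_chains k.+1 A I)%:R *: binomial_poly k).[t].
  rewrite [RHS]big_ord_recr /= -/(proper_chains #|P|.+1 A I).
  by rewrite proper_chains_gt_card ?ltnS ?max_card // scale0r horner0 addr0.
by apply: eq_bigr => k _ /=; rewrite natr_sum scaler_suml horner_sum.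
Qed.

(** With [D] the diagonal matrix of the signs [(-1) ^ #|A|], the strict matrix is
    [D * zeta ^ (-1) * D]; its power [t] is [D * zeta ^ (- t) * D]. *)
Definition layer_poly s A I : {poly rat} :=
  if s then (-1) ^+ (#|A| + #|I|) *: (zeta_poly A I \Po - 'X)
  else zeta_poly A I.

Lemma layer_poly0 s A I : (layer_poly s A I).[0] = (A == I)%:R.
Proof.
case: s; rewrite /layer_poly ?zeta_poly0 // hornerZ horner_comp !hornerE oppr0.
rewrite zeta_poly0; case: eqP => [->|_]; last by rewrite mulr0.
by rewrite exprD -expr2 sqrr_sign mulr1.
Qed.

(** Expand [zeta ^ (t + 1)] as [zeta * zeta ^ t]; after exchanging the sums, the inner one is the
    product of [zeta] with its inverse. *)
Lemma zeta_poly_inv A I (t : rat) :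
  (zeta_poly A I).[t]
  = \sum_(J | layer true A J) (-1) ^+ (#|A| + #|J|) * (zeta_poly J I).[t + 1].
Proof.
under eq_bigr => J _ do rewrite zeta_polyS mulr_sumr.
rewrite (exchange_big_dep predT) //=.
under eq_bigr => K _ do rewrite -mulr_suml layer_mobius.
rewrite (bigD1 A) //= eqxx mul1r big1 ?addr0 // => K.
by rewrite eq_sym => /negPf->; rewrite mul0r.
Qed.

Lemma layer_polyS s A I (t : rat) :
  (layer_poly s A I).[t + 1] = \sum_(J | layer s A J) (layer_poly s J I).[t].
Proof.
case: s => /=; last exact: zeta_polyS.
rewrite hornerZ horner_comp !hornerE zeta_poly_inv mulr_sumr.
apply: eq_bigr => J _; rewrite hornerZ horner_comp hornerN hornerX opprD subrK.
rewrite mulrA; congr (_ * _).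
by rewrite !exprD mulrACA -expr2 sqrr_sign mul1r mulrC.
Qed.

(** * Counting labelings by peeling off the top label *)

Section Labelings.
Context (s : bool) (C : {set P}) (x y : nat).

(* Labelings of [A] by [{1, ..., n}]; the label 0 marks the elements outside
   [A]. *)
Definition labelings (n : nat) A : {set {ffun P -> 'I_x.+1}} :=
  [set f : {ffun P -> 'I_x.+1} |
    [&& [forall a, if a \in A then 0 < f a <= n else f a == ord0]%N,
        [forall a in A, forall b in A, (a < b)%O ==> (f a + s <= f b)]%N
      & [forall c in C :&: A, y <= f c]%N]].

Lemma labelingsP n A (f : {ffun P -> 'I_x.+1}) :
  reflect [/\ forall a, a \in A -> (0 < f a <= n)%N,
              forall a, a \notin A -> f a = ord0,
              forall a b, a \in A -> b \in A -> (a < b)%O -> (f a + s <= f b)%N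
            & forall c, c \in C -> c \in A -> (y <= f c)%N]
          (f \in labelings n A).
Proof.
rewrite inE; apply: (iffP and3P).
  move=> [/forallP vf /forall_inP mf /forall_inP cf].
  split.
  - by move=> a aA; have := vf a; rewrite aA.
  - by move=> a /negPf aA; apply/eqP; have := vf a; rewrite aA.
  - by move=> a b aA bA; apply/implyP; move/forall_inP: (mf a aA); apply.
  - by move=> c cC cA; apply: cf; rewrite inE cC.
case=> vf zf mf cf; split.
- by apply/forallP=> a; case: ifPn => [/vf //|/zf ->].
- by apply/forall_inP=> a aA; apply/forall_inP=> b bA; apply/implyP; exact: mf.
- by apply/forall_inP=> c /setIP[]; exact: cf.
Qed.

Lemma card_labelings0 A : #|labelings 0 A| = (A == set0).
Proof.
case: (eqVneq A set0) => [->|/set0Pn[a aA]].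
  transitivity #|[set [ffun=> ord0] : {ffun P -> 'I_x.+1}]|; last exact: cards1.
  apply: eq_card => f; rewrite [RHS]inE.
  apply/labelingsP/eqP => [[_ zf _ _]|->].
    by apply/ffunP=> a; rewrite ffunE zf ?inE.
  by split=> [a|a|a b|c]; rewrite ?inE ?ffunE.
apply: eq_card0 => f; apply/negP => /labelingsP[/(_ a aA)].
by case: (nat_of_ord _).
Qed.

(** Labelings are sorted by the set [I] of elements labelled at most [n]. The layer [A :\: I]
    carries the constant label [n + 1], so the celeste condition there reads: [y <= n + 1] or no
    celeste element. *)
Lemma card_labelingsS n A : (n < x)%N ->
  #|labelings n.+1 A| =
    (\sum_(I | layer s A I && ((y <= n.+1) || [disjoint A :\: I & C]))
        #|labelings n I|)%N.
Proof.
move=> nx; pose g (f : {ffun P -> 'I_x.+1}) := [set a in A | f a <= n]%N.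
rewrite -sum1_card (partition_big g
  (fun I => layer s A I && ((y <= n.+1)%N || [disjoint A :\: I & C]))) /=.
  apply: eq_bigr => I /andP[/layerP[IA dI aI] yC].
  pose ext (h : {ffun P -> 'I_x.+1}) :=
    [ffun a => if a \in A :\: I then inord n.+1 else h a].
  pose res (f : {ffun P -> 'I_x.+1}) :=
    [ffun a => if a \in I then f a else ord0].
  have topE : @inord x n.+1 = n.+1 :> nat by rewrite inordK // ltnS.
  (* Filling the top layer with [n + 1] and erasing it are mutually inverse. *)
  rewrite (reindex_onto ext res) /=; last first.
    move=> f /andP[/labelingsP[vf zf _ _] /eqP gf].
    apply/ffunP=> a; rewrite !ffunE; have := vf a; have := zf a.
    rewrite -gf !inE; case: (boolP (a \in A)) => //= aA; last by move=> ->.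
    move=> _ /(_ isT); case: (leqP (f a) n) => //= n_lt /andP[_ le_n].
    by apply: val_inj; rewrite /= topE; apply/eqP; rewrite eqn_leq n_lt le_n.
  rewrite sum1_card; apply: eq_card => h; rewrite [LHS]inE /=.
  have extI a : a \in I -> ext h a = h a by move=> aI'; rewrite ffunE inE aI'.
  have extD a : a \in A -> a \notin I -> ext h a = n.+1 :> nat.
    by move=> aA aI'; rewrite ffunE inE aA aI'.
  apply/andP/labelingsP => [[/andP[/labelingsP[vf zf mf cf] /eqP gf] /eqP rh]|].
    have sub a : a \in I -> a \in A by exact: (subsetP IA).
    split.
    - move=> a aI'; rewrite -extI //; have /andP[-> _] := vf a (sub a aI').
      by move: aI'; rewrite -gf inE => /andP[].
    - by move=> a aI'; rewrite -rh ffunE (negPf aI').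
    - by move=> a b aI' bI; rewrite -!extI //; apply: mf; exact: sub.
    - by move=> c cC cI; rewrite -extI //; apply: cf => //; exact: sub.
  case=> vh zh mh ch; split; first (apply/andP; split).
  - apply/labelingsP; split.
    + move=> a aA; case: (boolP (a \in I)) => aI'; last by rewrite extD ?leqnn.
      by rewrite extI //; case/andP: (vh a aI') => -> /leqW.
    + move=> a aA; rewrite ffunE inE (negPf aA) andbF zh //.
      by apply: contra aA; exact: (subsetP IA).
    + move=> a b aA bA ab; case: (boolP (b \in I)) => bI.
        by have aI' := dI _ _ aA bI ab; rewrite !extI // mh.
      rewrite [X in (_ <= X)%N]extD //; case: (boolP (a \in I)) => aI'.
        rewrite extI // -[n.+1]addn1 leq_add ?leq_b1 //.
        by case/andP: (vh a aI').
      have : ~~ s by apply/negP => hs; move/negP: (aI hs a b aA aI' bA bI).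
      by move/negPf->; rewrite addn0 extD.
    + move=> c cC cA; case: (boolP (c \in I)) => cI.
        by rewrite extI // ch.
      rewrite extD //; case/orP: yC => // /disjointFr dAC.
      by rewrite dAC ?inE ?cA ?cI in cC.
  - apply/eqP/setP=> a; rewrite inE; case: (boolP (a \in I)) => aI'.
      by rewrite (subsetP IA) // extI //; case/andP: (vh a aI').
    by case: (boolP (a \in A)) => //= aA; rewrite extD // ltnn.
  - apply/eqP/ffunP=> a; rewrite ffunE; case: ifPn => [/extI //|aI'].
    by rewrite zh.
(* It remains to see that the set [g f] of every labeling is an admissible index. *)
move=> f /labelingsP[vf zf mf cf]; apply/andP; split.
  apply/layerP; split.
  - by apply/subsetP=> a; rewrite inE => /andP[].
  - move=> a b aA; rewrite !inE aA => /andP[bA fb] ab /=.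
    apply: leq_trans fb; apply: leq_trans (mf _ _ aA bA ab).
    exact: leq_addr.
  - move=> hs a b aA; rewrite !inE aA /= -ltnNge => fa bA.
    rewrite bA /= -ltnNge => fb.
    apply/negP => /(mf _ _ aA bA); rewrite hs addn1 => ab.
    have /andP[_ /(leq_trans ab)] := vf b bA.
    by rewrite ltnNge fa.
case: leqP => //= yn; rewrite disjoint_subset; apply/subsetP=> c.
rewrite !inE => /andP[gc cA]; apply/negP => cC.
have := cf c cC cA; apply/negP; rewrite -ltnNge; apply: leq_trans yn.
by case/andP: (vf c cA).
Qed.

(** All labels lie below the threshold, so no layer may contain a celeste element; otherwise the
    count is a plain matrix power. *)
Lemma card_labelings_low n A : (n < y)%N -> (n <= x)%N ->
  #|labelings n A|%:R
    = [disjoint A & C]%:R * (layer_poly s A set0).[n%:R] :> rat.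
Proof.
elim: n A => [|n IH] A ny nx.
  rewrite card_labelings0 layer_poly0.
  case: eqP => [->|_]; last by rewrite mulr0.
  by rewrite -setI_eq0 set0I !eqxx mulr1.
rewrite card_labelingsS // leqNgt ny /= natr_sum -natr1 layer_polyS mulr_sumr.
rewrite big_mkcondr /=; apply: eq_bigr => I /layerP[IA _ _].
rewrite IH ?(ltnW ny) ?(ltnW nx) //.
have -> : [disjoint A & C] = [disjoint A :\: I & C] && [disjoint I & C].
  rewrite -!setI_eq0 -[in LHS](setID A I) (setIidPr IA) setIUl setU_eq0.
  exact: andbC.
by case: ifP => _; rewrite ?mul0r.
Qed.

(** Here [I] is the set of elements labelled at most [m], hence below the threshold; the [n - m]
    layers above it are unconstrained. *)
Lemma card_labelings_high m n A : y = m.+1 -> (m <= n <= x)%N ->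
  #|labelings n A|%:R
    = \sum_(I : {set P} | [disjoint I & C])
        (layer_poly s A I).[n%:R - m%:R] * (layer_poly s I set0).[m%:R] :> rat.
Proof.
move=> ym /andP[/subnKC <-]; set k := (n - m)%N; rewrite natrD addrC addKr.
elim: k A => [|k IH] A mkx.
  (* With no layer above the threshold, the upper factor is the identity matrix and only [I = A]
     survives. *)
  rewrite addn0 in mkx *; rewrite card_labelings_low ?ym //.
  rewrite big_mkcond (bigD1 A) //= layer_poly0 eqxx mul1r big1 ?addr0.
    by case: ifP => _; rewrite ?mul1r ?mul0r.
  by move=> I; rewrite eq_sym layer_poly0 => /negPf->; rewrite mul0r if_same.
rewrite addnS in mkx *; rewrite card_labelingsS // ym ltnS leq_addr.
under eq_bigl => I do rewrite andbT.
rewrite natr_sum; under eq_bigr => I _ do rewrite IH ?(ltnW mkx) //.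
rewrite exchange_big /=; apply: eq_bigr => I _.
by rewrite -mulr_suml -natr1 layer_polyS.
Qed.

End Labelings.

(** * Order preserving maps as labelings of the whole poset *)

(** Sends the ordinal [i] to the label [i + 1] it stands for, leaving 0 as the mark of absence. *)
Definition shift_label (x : nat) (f : {ffun P -> 'I_x}) : {ffun P -> 'I_x.+1} :=
  [ffun a => lift ord0 (f a)].

Lemma card_labelings_setT s C x y (Q : pred {ffun P -> 'I_x}) :
    (forall f : {ffun P -> 'I_x}, Q f =
      [forall a, forall b, (a < b)%O ==> (f a + s <= f b)%N]
      && [forall c in C, y <= (f c).+1]%N) ->
  #|[set f | Q f]| = #|labelings s C x y x setT|.
Proof.
move=> QE; have shift_inj : injective (@shift_label x).
  move=> f g /ffunP fg; apply/ffunP=> a; have := fg a.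
  by rewrite !ffunE => /lift_inj.
rewrite -(card_imset _ shift_inj); apply: eq_card => h.
apply/imsetP/labelingsP => [[f + ->]|[vh _ mh ch]].
  rewrite inE QE => /andP[/forallP mf /forall_inP cf].
  split=> [a _|a|a b _ _ ab|c cC _].
  - by rewrite ffunE lift0 /=.
  - by rewrite inE.
  - rewrite !ffunE !lift0 /= addSn ltnS.
    by move/forallP: (mf a) => /(_ b)/implyP->.
  - by rewrite ffunE lift0 /=; exact: cf.
have pred_lt a : ((h a).-1 < x)%N.
  by have /andP[] := vh a (in_setT a); case: (nat_of_ord _).
pose f := [ffun a => Ordinal (pred_lt a)].
have fE a : (f a).+1 = h a.
  by rewrite ffunE /= prednK //; have /andP[] := vh a (in_setT a).
exists f; last first.
  by apply/ffunP=> a; apply: ord_inj; rewrite -fE [shift_label f a]ffunE lift0.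
rewrite inE QE; apply/andP; split.
  apply/forallP=> a; apply/forallP=> b; apply/implyP=> ab.
  by rewrite -ltnS -addSn !fE mh.
by apply/forall_inP=> c cC; rewrite fE ch.
Qed.

Lemma OmegaE C x y : Omega C x y = #|labelings false C x y x setT|.
Proof.
apply: card_labelings_setT => f; rewrite /order_preserving_map; congr (_ && _).
apply/forallP/forallP => mf a; apply/forallP=> b; apply/implyP.
  by rewrite addn0 => /ltW; move/forallP: (mf a) => /(_ b)/implyP.
rewrite le_eqVlt => /predU1P[-> //|].
by move/forallP: (mf a) => /(_ b)/implyP; rewrite addn0.
Qed.

(** The strict celeste bound turns the threshold [y] into [y + 1]. *)
Lemma Omega_strictE C x y :
  Omega_strict C x y = #|labelings true C x y.+1 x setT|.
Proof.
apply: card_labelings_setT => f; congr (_ && _).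
by apply: eq_forallb => a; apply: eq_forallb => b; rewrite addn1.
Qed.

(** * The bivariate polynomials and their reciprocity *)

(* [u] and [v] are the numbers of labels above and below the threshold. *)
Definition bicolored_poly s C (u v : {poly {poly rat}}) : {poly {poly rat}} :=
  \sum_(I : {set P} | [disjoint I & C])
     ((layer_poly s setT I)^:P \Po u) * ((layer_poly s I set0)^:P \Po v).

Lemma horner_bicolored_poly s C u v (x y : rat) :
  (bicolored_poly s C u v).[x, y]
    = \sum_(I : {set P} | [disjoint I & C])
        (layer_poly s setT I).[u.[x, y]] * (layer_poly s I set0).[v.[x, y]].
Proof.
rewrite /bicolored_poly !horner_sum; apply: eq_bigr => I _.
by rewrite !hornerM !horner2_comp.
Qed.

(** A celeste element may have label [y] in the weak case but not in the strict one, so the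
    forbidden labels number [y - 1] here and [y] in the strict case. *)
Definition Omega_poly C : {poly {poly rat}} :=
  bicolored_poly false C ('X - 'Y + 1) ('Y - 1).

Definition Omega_strict_poly C : {poly {poly rat}} :=
  bicolored_poly true C ('X - 'Y) 'Y.

Lemma OmegaP C : is_given_by_polynomial (Omega C) (Omega_poly C).
Proof.
move=> x [//|y] /= yx; rewrite OmegaE horner_bicolored_poly !hornerE.
rewrite (@card_labelings_high _ _ _ _ y) ?(ltnW yx) ?leqnn //.
by rewrite -natr1 addrK opprD addrA subrK.
Qed.

Lemma Omega_strictP C :
  is_given_by_polynomial (Omega_strict C) (Omega_strict_poly C).
Proof.
move=> x y /andP[_ yx]; rewrite Omega_strictE horner_bicolored_poly !hornerE.
by rewrite (@card_labelings_high _ _ _ _ y) ?yx ?leqnn.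
Qed.

(** At [y + 1] the weak arguments are [x - y] and [y], the negatives of the strict ones at
    [(- x, - y)]. The two factors contribute the signs [(-1) ^ (#|P| + #|I|)] and [(-1) ^ #|I|],
    whose product is [(-1) ^ #|P|] for every [I]. *)
Lemma Omega_poly_reciprocity C (x y : rat) :
  (-1) ^+ #|P| * (Omega_strict_poly C).[- x, - y] = (Omega_poly C).[x, y + 1].
Proof.
rewrite !horner_bicolored_poly !hornerE mulr_sumr; apply: eq_bigr => I _.
rewrite /layer_poly !hornerZ !horner_comp !hornerN !hornerX.
rewrite cards0 addn0 cardsT exprD opprK addrK.
have -> : - (- x + y) = x - y by ring.
have -> : x - (y + 1) + 1 = x - y by ring.
transitivity (((-1) ^+ #|P|) ^+ 2 * ((-1) ^+ #|I|) ^+ 2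
    * ((zeta_poly setT I).[x - y] * (zeta_poly I set0).[y])); first by ring.
by rewrite !sqrr_sign !mul1r.
Qed.

End Layers.

Theorem theorem1 (d : Order.disp_t) (P : finPOrderType d) (C : {set P}) :
  (exists p : {poly {poly rat}}, is_given_by_polynomial (Omega C) p) /\
  (exists q : {poly {poly rat}}, is_given_by_polynomial (Omega_strict C) q) /\
  (forall p q : {poly {poly rat}},
     is_given_by_polynomial (Omega C) p ->
     is_given_by_polynomial (Omega_strict C) q ->
     forall x y : rat,
       ((-1) ^+ #|P| * q.[- x, - y] = p.[x, y + 1])%R).
Proof.
split; first by exists (Omega_poly C); exact: OmegaP.
split; first by exists (Omega_strict_poly C); exact: Omega_strictP.
move=> p q Cp Cq x y.
(* By uniqueness, [p] and [q] are the explicit polynomials. *)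
rewrite (given_by_polynomial_uniq Cp (@OmegaP _ _ C)).
rewrite (given_by_polynomial_uniq Cq (@Omega_strictP _ _ C)).
exact: Omega_poly_reciprocity.
Qed.
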